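(* Let $p=p(x)$ be a polynomial with real coefficients of degree $d$ in $n$ variables $x=(x_1,\dots,x_n)$, with gradient $\nabla p(x)$ and Hessian $H(x)$. Define the following polynomials in the $2n$ variables $(x,y)$, for $\lambda\in[0,1]$: $$g_{\lambda}(x,y)=(1-\lambda)p(x)+\lambda p(y)-p((1-\lambda)x+\lambda y),$$ $$g_{\nabla}(x,y)=p(y)-p(x)-\nabla p(x)^T(y-x),$$ $$g_{\nabla^2}(x,y)=y^TH(x)y.$$ Then the following are equivalent: (a) $g_{\frac12}(x,y)$ is a sum of squares; (b) $g_{\nabla}(x,y)$ is a sum of squares; (c) $g_{\nabla^2}(x,y)$ is a sum of squares (i.e., $H(x)$ is an sos-matrix).
   Context: A polynomial is a sum of squares (sos) if it equals $\sum_{i=1}^m q_i^2$ for finitely many polynomials $q_i$ with real coefficients. A symmetric polynomial matrix $U(x)\in\mathbb{R}[x]^{m\times m}$ is an sos-matrix if $U(x)=V(x)^TV(x)$ for some polynomial matrix $V(x)\in\mathbb{R}[x]^{s\times m}$ and some $s\in\mathbb{N}$; it is known that this holds if and only if the scalar polynomial $y^TU(x)y$ is a sum of squares in $\mathbb{R}[x;y]$. *)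

(* Defs.v *)
From HB Require Import structures.
From mathcomp Require Import all_boot all_order all_algebra.
From mathcomp Require Import reals.
From mathcomp Require Import mpoly.

Set Implicit Arguments.
Unset Strict Implicit.
Unset Printing Implicit Defensive.

Import GRing.Theory.
Local Open Scope ring_scope.

Definition is_sos (R : realType) (N : nat) (q : {mpoly R[N]}) : Prop :=
  exists (m : nat) (f : 'I_m -> {mpoly R[N]}), q = \sum_(i < m) f i ^+ 2.

(* Symmetry of U is not a separate clause: it follows from U = V^T *m V. *)
Definition is_sos_matrix (R : realType) (N m : nat)
    (U : 'M[{mpoly R[N]}]_m) : Prop :=
  exists (s : nat) (V : 'M[{mpoly R[N]}]_(s, m)), U = V^T *m V.

Definition gradient (R : realType) (n : nat) (p : {mpoly R[n]}) :
    'cV[{mpoly R[n]}]_n :=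
  \col_i p^`M(i).

Definition hessian (R : realType) (n : nat) (p : {mpoly R[n]}) :
    'M[{mpoly R[n]}]_n :=
  \matrix_(i, j) p^`M(j)^`M(i).

(* R[x; y] is {mpoly R[n + n]}: the first n variables are x, the last n are y. *)
Definition xvars (R : realType) (n : nat) : 'cV[{mpoly R[n + n]}]_n :=
  \col_i 'X_(lshift n i).

Definition yvars (R : realType) (n : nat) : 'cV[{mpoly R[n + n]}]_n :=
  \col_i 'X_(rshift n i).

Definition msubst (R : realType) (n N : nat) (v : 'cV[{mpoly R[N]}]_n)
    (p : {mpoly R[n]}) : {mpoly R[N]} :=
  p \mPo [tuple v i 0 | i < n].

Definition g_lambda (R : realType) (n : nat) (p : {mpoly R[n]}) (lambda : R) :
    {mpoly R[n + n]} :=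
  let x := xvars R n in
  let y := yvars R n in
  (1 - lambda) *: msubst x p + lambda *: msubst y p
  - msubst ((1 - lambda)%:MP *: x + lambda%:MP *: y) p.

(* A product of a row and a column is a 1 x 1 matrix, whence the (0, 0) entry. *)
Definition g_grad (R : realType) (n : nat) (p : {mpoly R[n]}) :
    {mpoly R[n + n]} :=
  let x := xvars R n in
  let y := yvars R n in
  msubst y p - msubst x p
  - ((map_mx (msubst x) (gradient p))^T *m (y - x)) 0 0.

Definition g_hess (R : realType) (n : nat) (p : {mpoly R[n]}) :
    {mpoly R[n + n]} :=
  let x := xvars R n in
  let y := yvars R n in
  (y^T *m map_mx (msubst x) (hessian p) *m y) 0 0.

(* Main.v *)
Require Import Defs.
From HB Require Import structures.
From mathcomp Require Import all_boot all_order all_algebra.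
From mathcomp Require Import reals.
From mathcomp Require Import mpoly.
From mathcomp Require Import ring lra.

(** The Hessian H being an sos-matrix is the hub, linked to the other conditions
    by polynomial identities.

    Towards the Hessian.  Let G = \sum_k f_k^2 vanish on a subspace such as
    y = x or y = 0.  A sum of squares of real polynomials vanishes only if
    every term does ([sum_sqr_eq0]), so every f_k vanishes there too, and of
    the second derivatives of f_k^2 only the products 2 d_i f_k d_j f_k
    survive: the matrix of second derivatives of G along the subspace is an
    sos-matrix ([sos_second_derivatives]).  For g_{1/2} on y = x this matrix is
    H/4, and for y^T H y on y = 0 it is 2H.

    From the Hessian.  Put phi(t) = p(x + t(y - x)).  If H = V^T V, then
    phi'' = \sum_k w_k(t)^2, and g_grad = phi(1) - phi(0) - phi'(0) is
    \int_0^1 (1 - t) phi''(t) dt, which depends on the coefficients w_(k,a)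
    of w_k through the quadratic form with matrix
    1/((a + b + 1)(a + b + 2)).  This matrix is the entrywise product of the
    two Cauchy matrices 1/(u_a + u_b) with u_a = a + 1/2 and u_a = a + 1.
    Each is an explicit Gram matrix ([cauchy_kernel_gram]), hence so is the
    product, and the integral is a finite sum of squares
    ([taylor_remainder_sos]).

    Finally g_{1/2}(x, y) = (g_grad(m, x) + g_grad(m, y))/2 with
    m = (x + y)/2, because the gradient terms at m cancel. *)

Set Implicit Arguments.
Unset Strict Implicit.
Unset Printing Implicit Defensive.

Import Order.TTheory GRing.Theory Num.Theory.
Local Open Scope ring_scope.

(** * Substitution and the chain rule *)

HB.instance Definition _ (R : realType) (n N : nat) (v : 'cV[{mpoly R[N]}]_n) :=
  GRing.LRMorphism.copy (msubst v) (comp_mpoly [tuple v i 0 | i < n]).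

Section ChainRule.
Variables (R A : comNzRingType) (n : nat).
Variables (f : {rmorphism R -> A}) (h : 'I_n -> A).
Variable D : {additive A -> A}.
Hypothesis DM : forall a b, D (a * b) = D a * b + a * D b.
Hypothesis Df : forall c, D (f c) = 0.

(** A derivation killing the constants is determined by its values at the
    variables; this covers both the partial derivatives of [{mpoly _}] and the
    derivative in [t] of a polynomial along a line. *)
Lemma chain_rule (p : {mpoly R[n]}) :
  D (mmap f h p) = \sum_i mmap f h p^`M(i) * D (h i).
Proof.
have D1 : D 1 = 0 by rewrite -(rmorph1 f) Df.
pose P (p : {mpoly R[n]}) :=
  D (mmap f h p) = \sum_i mmap f h p^`M(i) * D (h i).
have P1 : P 1.
  by rewrite /P rmorph1 D1 big1 // => i _; rewrite mderivC raddf0 mul0r.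
have PM q r : P q -> P r -> P (q * r).
  rewrite /P rmorphM DM /= => -> ->; rewrite mulr_suml mulr_sumr -big_split /=.
  apply: eq_bigr => i _; rewrite mderivM rmorphD !rmorphM /= mulrDl.
  by rewrite mulrA mulrAC.
have PX i : P 'X_i.
  rewrite /P mmapX mmap1U (bigD1 i) //= big1 => [|j ji].
    rewrite addr0 mderivX mnm1E eqxx scale1r.
    have -> : (U_(i) - U_(i))%MM = 0%MM by apply/mnmP=> k; rewrite !mnmE subnn.
    by rewrite mpolyX0 rmorph1 mul1r.
  by rewrite mderivX mnm1E eq_sym (negPf ji) scale0r raddf0 mul0r.
elim/mpolyind: p => [|c m p _ _ IH].
  by rewrite !raddf0 big1 // => i _; rewrite !raddf0 mul0r.
have PXm : P 'X_[m].
  rewrite mpolyXE_id; apply: big_ind => // i _.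
  by elim: (m i) => [|k IHk]; rewrite ?expr0 ?exprS //; apply: PM.
rewrite mmapD raddfD mmapZ DM Df mul0r add0r /= PXm IH mulr_sumr -big_split /=.
apply: eq_bigr => i _; rewrite mderivD mderivZ mmapD mmapZ /=.
by rewrite mulrDl mulrA.
Qed.

End ChainRule.

Lemma mderiv_msubst (R : realType) (n N : nat) (v : 'cV[{mpoly R[N]}]_n)
    (p : {mpoly R[n]}) (k : 'I_N) :
  (msubst v p)^`M(k) = \sum_i msubst v p^`M(i) * (v i 0)^`M(k).
Proof.
rewrite [LHS](chain_rule _ _ (D := mderiv k)) /=; last first.
- by move=> c; rewrite mderivC.
- by move=> a b; rewrite mderivM.
by apply: eq_bigr => i _; rewrite tnth_mktuple.
Qed.

Lemma mderiv_sum (R : nzRingType) (N : nat) (I : finType) (k : 'I_N)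
    (F : I -> {mpoly R[N]}) : (\sum_i F i)^`M(k) = \sum_i (F i)^`M(k).
Proof. exact: (raddf_sum (mderiv k)). Qed.

Lemma msubst_comp (R : realType) (n N M : nat) (w : 'cV[{mpoly R[M]}]_N)
    (v : 'cV[{mpoly R[N]}]_n) (p : {mpoly R[n]}) :
  msubst w (msubst v p) = msubst (map_mx (msubst w) v) p.
Proof.
rewrite [msubst v p]/(mmap _ _ _) [RHS]/(mmap _ _ _) /mmap rmorph_sum.
apply: eq_bigr => m _; rewrite rmorphM /= /mmap1 rmorph_prod /=.
rewrite [msubst w _%:MP]comp_mpolyC; congr (_ * _).
by apply: eq_bigr => i _; rewrite rmorphXn /= !tnth_mktuple mxE.
Qed.

Lemma msubst_id (R : realType) (n : nat) (p : {mpoly R[n]}) :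
  msubst (\col_i 'X_i) p = p.
Proof.
rewrite -[RHS]comp_mpoly_id /msubst; congr (_ \mPo _).
by apply: eq_mktuple => i; rewrite mxE.
Qed.

(** * Sums of squares *)

Section Sos.
Variables (R : realType) (N : nat).
Implicit Types q : {mpoly R[N]}.

Lemma is_sos0 : is_sos (0 : {mpoly R[N]}).
Proof. by exists 0%N, (fun=> 0); rewrite big_ord0. Qed.

Lemma is_sos_sqr q : is_sos (q ^+ 2).
Proof. by exists 1%N, (fun=> q); rewrite big_ord1. Qed.

Lemma is_sosD q1 q2 : is_sos q1 -> is_sos q2 -> is_sos (q1 + q2).
Proof.
move=> [m1 [f1 ->]] [m2 [f2 ->]]; exists (m1 + m2)%N.
exists (fun i => match split i with inl j => f1 j | inr j => f2 j end).
rewrite big_split_ord /=; congr (_ + _); apply: eq_bigr => i _.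
  by rewrite (unsplitK (inl i)).
by rewrite (unsplitK (inr i)).
Qed.

Lemma is_sos_sum (I : finType) (F : I -> {mpoly R[N]}) :
  (forall i, is_sos (F i)) -> is_sos (\sum_i F i).
Proof.
by move=> sosF; apply: big_ind => //; [exact: is_sos0|exact: is_sosD].
Qed.

Lemma is_sosZ (c : R) q : 0 <= c -> is_sos q -> is_sos (c *: q).
Proof.
move=> c0 [m [f ->]]; exists m, (fun i => Num.sqrt c *: f i).
by rewrite scaler_sumr; apply: eq_bigr => i _; rewrite exprZn sqr_sqrtr.
Qed.

Lemma is_sos_msubst M (v : 'cV[{mpoly R[M]}]_N) q :
  is_sos q -> is_sos (msubst v q).
Proof.
move=> [m [f ->]]; exists m, (msubst v \o f).
by rewrite rmorph_sum; apply: eq_bigr => i _; rewrite rmorphXn.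
Qed.

(** At the square of the largest leading monomial M of the [f i], the sum has
    coefficient [\sum_i (f i)@_M ^+ 2], a sum of squares of reals, which cannot
    cancel. *)
Lemma sum_sqr_eq0 (I : finType) (f : I -> {mpoly R[N]}) :
  \sum_i f i ^+ 2 = 0 -> forall i, f i = 0.
Proof.
move=> f0 i.
case: (@arg_maxP _ _ I i xpredT (fun i => mlead (f i))) => // i0 _ maxi0.
set M := mlead (f i0); have leM j : (mlead (f j) <= M)%O by exact: maxi0.
have fM j : (f j)@_M = 0.
  have := congr1 (mcoeff (M + M)) f0; rewrite raddf_sum mcoeff0 /= => /eqP.
  under eq_bigr => k _ do rewrite expr2 (mleadcMW (leM k) (leM k)) -expr2.
  rewrite psumr_eq0 => [/allP/(_ j)|k _]; last exact: sqr_ge0.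
  by rewrite mem_index_enum sqrf_eq0 => /(_ isT)/eqP.
(* The leading coefficient of [f i0] is thus 0, so M is the exponent of the
   constant term, and each [f j] is constant. *)
have f_i0 : f i0 = 0 by apply/eqP; rewrite -mleadc_eq0 fM.
have leadM j : mlead (f j) = M.
  by apply: le_anti; rewrite leM /M f_i0 mlead0 le0m.
by apply/eqP; rewrite -mleadc_eq0 leadM fM.
Qed.

End Sos.

Lemma is_sos_matrixZ (R : realType) (N m : nat) (c : R)
    (U : 'M[{mpoly R[N]}]_m) :
  0 <= c -> is_sos_matrix U -> is_sos_matrix (c%:MP *: U).
Proof.
move=> c0 [s [V ->]]; exists s, ((Num.sqrt c)%:MP *: V).
rewrite [(_ *: V)^T]linearZ /= -scalemxAl -scalemxAr scalerA -mpolyCM.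
by rewrite -expr2 sqr_sqrtr.
Qed.

(** [v] parametrizes a subvariety and [y] selects the variables to differentiate
    in.  Each squared polynomial vanishes on the subvariety, so the second
    derivatives of its square reduce there to twice the products of its first
    derivatives, and these products form a Gram matrix. *)
Lemma sos_second_derivatives (R : realType) (N n M : nat) (G : {mpoly R[N]})
    (v : 'cV[{mpoly R[M]}]_N) (y : 'I_n -> 'I_N) :
  is_sos G -> msubst v G = 0 ->
  is_sos_matrix (\matrix_(i, j) msubst v (G^`M(y j)^`M(y i))).
Proof.
move=> [m [f defG]] vG0.
have vf0 k : msubst v (f k) = 0.
  apply: (sum_sqr_eq0 (f := msubst v \o f)); rewrite -[RHS]vG0 defG rmorph_sum.
  by apply: eq_bigr => i _; rewrite rmorphXn.
pose V := \matrix_(k, j) msubst v (f k)^`M(y j).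
suff -> : \matrix_(i, j) msubst v (G^`M(y j)^`M(y i)) = 2%:MP *: (V^T *m V).
  by apply: is_sos_matrixZ => //; exists m, V.
apply/matrixP => i j; rewrite !mxE defG !mderiv_sum rmorph_sum mulr_sumr.
apply: eq_bigr => k _.
rewrite !mxE expr2 !mderivM raddfD /= !mderivM.
by rewrite !rmorphD !rmorphM /= !vf0 mpolyC1; ring.
Qed.

(** * The polynomials of the theorem under substitution and differentiation *)

Section Convexity.
Variables (R : realType) (n : nat).
Implicit Types p : {mpoly R[n]}.
Local Notation x := (xvars R n).
Local Notation y := (yvars R n).

Lemma mderiv_msubst_single N (v : 'cV[{mpoly R[N]}]_n) p (k : 'I_N) (j : 'I_n)
    (c : R) :
  (forall i, (v i 0)^`M(k) = (c *+ (i == j))%:MP) ->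
  (msubst v p)^`M(k) = c *: msubst v p^`M(j).
Proof.
move=> dv; rewrite mderiv_msubst (bigD1 j) //= big1 => [|i ij].
  by rewrite addr0 dv eqxx mulrC mul_mpolyC.
by rewrite dv (negPf ij) mpolyC0 mulr0.
Qed.

Lemma dy_xvars i j : (x i 0)^`M(rshift n j) = 0.
Proof. by rewrite mxE mderivX mnm1E eq_lrshift scale0r. Qed.

Lemma dy_yvars i j : (y i 0)^`M(rshift n j) = (i == j)%:R%:MP.
Proof.
rewrite mxE mderivX mnm1E eq_rshift; case: eqP => [->|_]; last first.
  by rewrite scale0r mpolyC0.
suff -> : (U_(rshift n j) - U_(rshift n j) = 0)%MM.
  by rewrite mpolyX0 scale1r mpolyC1.
by apply/mnmP => k; rewrite !mnmE subnn.
Qed.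

Lemma dy_msubst_x p j : (msubst x p)^`M(rshift n j) = 0.
Proof.
rewrite (@mderiv_msubst_single _ _ _ _ j 0) ?scale0r // => i.
by rewrite dy_xvars mul0rn mpolyC0.
Qed.

Lemma dy_msubst_y p j : (msubst y p)^`M(rshift n j) = msubst y p^`M(j).
Proof.
rewrite (@mderiv_msubst_single _ _ _ _ j 1) ?scale1r // => i.
by rewrite dy_yvars.
Qed.

Lemma dy_msubst_segment p j (a b : R) :
  (msubst (a%:MP *: x + b%:MP *: y) p)^`M(rshift n j)
  = b *: msubst (a%:MP *: x + b%:MP *: y) p^`M(j).
Proof.
rewrite (@mderiv_msubst_single _ _ _ _ j b) // => i.
rewrite mxE [(a%:MP *: x) i 0]mxE [(b%:MP *: y) i 0]mxE mderivD !mderiv_mulC.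
by rewrite dy_xvars dy_yvars mulr0 add0r -mpolyCM mulr_natr.
Qed.

(** Stacking [u] on [v] substitutes [u] for [x] and [v] for [y]. *)
Lemma msubst_xvars N (u v : 'cV[{mpoly R[N]}]_n) :
  map_mx (msubst (col_mx u v)) x = u.
Proof.
apply/matrixP => i k; rewrite !mxE ord1 [LHS]comp_mpolyXU.
by rewrite -tnth_nth tnth_mktuple col_mxEu.
Qed.

Lemma msubst_yvars N (u v : 'cV[{mpoly R[N]}]_n) :
  map_mx (msubst (col_mx u v)) y = v.
Proof.
apply/matrixP => i k; rewrite !mxE ord1 [LHS]comp_mpolyXU.
by rewrite -tnth_nth tnth_mktuple col_mxEd.
Qed.

Lemma msubst_g_grad N (u v : 'cV[{mpoly R[N]}]_n) p :
  msubst (col_mx u v) (g_grad p)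
  = msubst v p - msubst u p - \sum_i msubst u p^`M(i) * (v i 0 - u i 0).
Proof.
rewrite /g_grad !rmorphB /= !msubst_comp msubst_xvars msubst_yvars.
congr (_ - _).
rewrite mxE rmorph_sum; apply: eq_bigr => i _.
rewrite !mxE rmorphM rmorphB /= msubst_comp msubst_xvars; congr (_ * _).
have E (w : 'cV[{mpoly R[n+n]}]_n) : msubst (col_mx u v) (w i 0) =
  map_mx (msubst (col_mx u v)) w i 0 by rewrite mxE.
by have := E x; have := E y; rewrite msubst_xvars msubst_yvars !mxE => -> ->.
Qed.

(** Expanding [p] to first order at the midpoint [m] towards [x] and towards
    [y], the gradient terms are opposite. *)
Lemma g_lambda_half p : let m := 2^-1%:MP *: x + 2^-1%:MP *: y in
  g_lambda p 2^-1 = 2^-1 *: (msubst (col_mx m x) (g_grad p)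
                             + msubst (col_mx m y) (g_grad p)).
Proof.
move=> m; rewrite !msubst_g_grad /g_lambda.
have -> : 1 - 2^-1 = 2^-1 :> R by lra.
rewrite -/m addrACA -opprD -big_split /= big1 => [|i _].
  rewrite subr0 addrACA -opprD -mulr2n scalerBr scalerDr addrC.
  rewrite -[msubst m p *+ 2]scaler_nat.
  by rewrite scalerA mulVf ?pnatr_eq0 // scale1r addrC.
have half : 2^-1%:MP *+ 2 = 1 :> {mpoly R[n + n]}.
  by rewrite -mpolyCMn -[_ *+ 2]mulr_natr mulVf ?pnatr_eq0.
have halfE q : q = 2^-1%:MP * q + 2^-1%:MP * q :> {mpoly R[n + n]}.
  by rewrite -mulrDl -mulr2n half mul1r.
rewrite -mulrDr [m i 0]mxE [(2^-1%:MP *: x) i 0]mxE [(2^-1%:MP *: y) i 0]mxE.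
by rewrite [X in X - _ + _]halfE [X in _ + (X - _)]halfE; ring.
Qed.

(** * Between the sums of squares and the Hessian *)

Lemma sos_g_lambda_of_g_grad p : is_sos (g_grad p) -> is_sos (g_lambda p 2^-1).
Proof.
move=> sos; rewrite g_lambda_half; apply: is_sosZ; first by rewrite invr_ge0.
by apply: is_sosD; apply: is_sos_msubst.
Qed.

(** On the diagonal y = x, two derivatives in y turn g_{1/2} into
    (1/2 - 1/4) H, whence the factor 4. *)
Lemma sos_hessian_of_g_lambda p :
  is_sos (g_lambda p 2^-1) -> is_sos_matrix (hessian p).
Proof.
pose X := \col_i 'X_i : 'cV[{mpoly R[n]}]_n.
pose m := 2^-1%:MP *: x + 2^-1%:MP *: y.
have halfD : 2^-1 + 2^-1 = 1 :> R by lra.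
have segX : map_mx (msubst (col_mx X X)) m = X.
  rewrite map_mxD !map_mxZ msubst_xvars msubst_yvars -scalerDl -rmorphD.
  by rewrite -mpolyCD halfD mpolyC1 rmorph1 scale1r.
have half : 1 - 2^-1 = 2^-1 :> R by lra.
move=> /(sos_second_derivatives (v := col_mx X X) (@rshift n n)) sosG.
have {sosG}/sosG : msubst (col_mx X X) (g_lambda p 2^-1) = 0.
  rewrite /g_lambda half rmorphB rmorphD /= !linearZ /= !msubst_comp segX.
  rewrite msubst_xvars msubst_yvars -scalerDl halfD scale1r.
  exact: subrr.
set U := \matrix_(i, j) _.
suff -> : hessian p = 4%:MP *: U by apply: is_sos_matrixZ.
apply/matrixP => i j; rewrite !mxE /g_lambda half.
rewrite !(mderivB, mderivD, mderivZ, dy_msubst_x, dy_msubst_y).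
rewrite !(dy_msubst_segment, mderivZ) mderiv0 !scaler0 !add0r.
rewrite rmorphB /= !linearZ /= !msubst_comp segX msubst_yvars msubst_id.
rewrite !scalerN !scalerA -scalerBl mul_mpolyC scalerA.
by rewrite -[LHS]scale1r; congr (_ *: _); lra.
Qed.

(** [y] occurs only quadratically in y^T H y, so two derivatives in y at y = 0
    recover 2H: this is how [V] is extracted from the squares. *)
Lemma sos_hessian_of_g_hess p : is_sos (g_hess p) -> is_sos_matrix (hessian p).
Proof.
pose X := \col_i 'X_i : 'cV[{mpoly R[n]}]_n.
pose y0 : 'cV[{mpoly R[n]}]_n := 0.
have g_hessE : g_hess p =
    \sum_a \sum_b y a 0 * (y b 0 * msubst x (hessian p b a)).
  rewrite /g_hess mxE; apply: eq_bigr => a _; rewrite mxE mulrC mulr_sumr.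
  by apply: eq_bigr => b _; rewrite [y^T 0 b]mxE [map_mx _ _ _ _]mxE.
have y0E a : msubst (col_mx X y0) (y a 0) = 0.
  have := msubst_yvars X y0 => /matrixP/(_ a 0).
  by rewrite mxE [y0 a 0]mxE.
move=> /(sos_second_derivatives (v := col_mx X y0) (@rshift n n)) sosG.
have {sosG}/sosG : msubst (col_mx X y0) (g_hess p) = 0.
  rewrite g_hessE rmorph_sum big1 // => a _.
  by rewrite rmorph_sum big1 // => b _; rewrite rmorphM /= y0E mul0r.
set U := \matrix_(i, j) _.
suff -> : hessian p = 2^-1%:MP *: U by apply: is_sos_matrixZ; rewrite invr_ge0.
have hess_sym i j : hessian p i j = hessian p j i by rewrite !mxE mderiv_comm.
suff UE i j : U i j = 2%:MP * hessian p i j.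
  apply/matrixP => i j; rewrite [RHS]mxE UE mulrA -mpolyCM mulVf ?pnatr_eq0 //.
  by rewrite mpolyC1 mul1r.
rewrite mxE g_hessE !mderiv_sum rmorph_sum.
transitivity (\sum_a \sum_b ((a == j)%:R * ((b == i)%:R * hessian p b a)
   + (a == i)%:R * ((b == j)%:R * hessian p b a))).
  apply: eq_bigr => a _; rewrite !mderiv_sum rmorph_sum; apply: eq_bigr => b _.
  rewrite !(mderivM, mderivD, dy_msubst_x, dy_yvars, mderivC, mderiv0).
  rewrite !(rmorphD, rmorphM) /= !y0E !msubst_comp !msubst_xvars !msubst_id.
  rewrite ![msubst _ _%:MP]comp_mpolyC !mpolyC_nat !rmorph0.
  ring.
have pick i' j' : \sum_a \sum_b (a == j')%:R * ((b == i')%:R * hessian p b a)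
     = hessian p i' j'.
  rewrite (bigD1 j') //= [X in _ + X]big1 => [|a /negPf ->]; last first.
    by apply: big1 => b _; rewrite mul0r.
  rewrite addr0 (bigD1 i') //= big1 => [|b /negPf ->]; last first.
    by rewrite mul0r mulr0.
  by rewrite !eqxx !mul1r addr0.
under eq_bigr do rewrite big_split.
rewrite big_split /= !pick [hessian p j i]hess_sym mpolyCD mpolyC1; ring.
Qed.

Lemma sos_g_hess_of_hessian p : is_sos_matrix (hessian p) -> is_sos (g_hess p).
Proof.
move=> [s [V defH]].
rewrite /g_hess defH map_mxM -map_trmx mulmxA -trmx_mul -mulmxA.
exists s, (fun k => (map_mx (msubst x) V *m y) k 0).
by rewrite mxE; apply: eq_bigr => k _; rewrite mxE expr2.
Qed.

End Convexity.

(** * The Taylor remainder of a sum of squares *)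

(** The Schur complement of the entry (l, l) of a Cauchy matrix is the same
    matrix with rows and columns rescaled by
    [c l a = (x a - x l) / (x a + x l)]; iterating this elimination gives an
    explicit Cholesky factor [v].  After [s] steps what remains has the factor
    [c a a = 0]. *)
Lemma cauchy_kernel_gram (R : realType) (x : nat -> R) (s : nat) :
  (forall a, 0 < x a) ->
  exists v : 'I_s -> nat -> R, forall a b, (a < s)%N ->
    (x a + x b)^-1 = \sum_(k < s) v k a * v k b.
Proof.
move=> x0.
pose c l a := (x a - x l) / (x a + x l).
pose v (k : nat) a := Num.sqrt (2 * x k) / (x a + x k) * \prod_(l < k) c l a.
exists v => a b lt_as.
have D0 i j : x i + x j != 0 by rewrite gt_eqF // addr_gt0.
suff tele t : (x a + x b)^-1 = \sum_(k < t) v k a * v k b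
    + (x a + x b)^-1 * \prod_(l < t) (c l a * c l b).
  rewrite (tele s) [\prod_(l < s) _](bigD1 (Ordinal lt_as)) //=.
  by rewrite [c a a]/c subrr !mul0r mulr0 addr0.
elim: t => [|t {1}->]; first by rewrite !big_ord0 add0r mulr1.
rewrite !big_ord_recr /= -addrA; congr (_ + _).
rewrite big_split /= /v mulrACA [_ * (_ / _)]mulrACA -expr2.
rewrite sqr_sqrtr; last by rewrite mulr_ge0 // ltW.
by rewrite /c; field; rewrite ?D0.
Qed.

(** The entrywise (Schur) product of two Gram matrices is the Gram matrix of the
    products of their factors. *)
Lemma taylor_weight_gram (R : realType) (s : nat) :
  exists v : 'I_s * 'I_s -> nat -> R, forall a b, (a < s)%N ->
    ((a + b).+1%:R * (a + b).+2%:R)^-1 = \sum_kl v kl a * v kl b.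
Proof.
have [//|v vE] := @cauchy_kernel_gram R (fun a => a%:R + 2^-1) s.
  by move=> a; rewrite ltr_wpDl ?invr_gt0.
have [//|w wE] := @cauchy_kernel_gram R (fun a => a%:R + 1) s.
  by move=> a; rewrite ltr_wpDl.
exists (fun kl a => v kl.1 a * w kl.2 a) => a b lt_as.
have -> : (a + b).+1%:R = a%:R + 2^-1 + (b%:R + 2^-1) :> R.
  by rewrite -natr1 natrD; lra.
have -> : (a + b).+2%:R = a%:R + 1 + (b%:R + 1) :> R.
  by rewrite -!natr1 natrD; lra.
rewrite invfM vE // wE // big_distrlr /= pair_big /=.
by apply: eq_bigr => kl _; rewrite mulrACA.
Qed.

Section Remainder.
Variables (R : realType) (N : nat).
Implicit Types phi psi w : {poly {mpoly R[N]}}.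

(** The integral of [(1 - t) * psi t] for [t] from 0 to 1, cut off at degree
    [M]: the moments of the weight are 1/((k + 1)(k + 2)).  The cutoff, rather
    than [size psi], makes it additive in [psi]. *)
Definition taylor_functional (M : nat) psi : {mpoly R[N]} :=
  \sum_(k < M) ((k.+1%:R * k.+2%:R)^-1 : R) *: psi`_k.

(** Taylor's formula with integral remainder: integrating the monomial of degree
    k twice divides its coefficient by (k + 1)(k + 2). *)
Lemma taylor_remainderE M phi : (size phi <= M.+2)%N ->
  phi.[1] - phi.[0] - phi^`().[0] = taylor_functional M phi^`()^`().
Proof.
move=> szM; rewrite !horner_coef0 (horner_coef_wide _ szM) !big_ord_recl /=.
rewrite coef_deriv mulr1n !expr1n !mulr1.
rewrite [_ + _ - phi`_0]addrC addKr addrC addKr.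
apply: eq_bigr => k _; rewrite expr1n mulr1 /bump /= !add1n.
rewrite !coef_deriv -mulrnA -scaler_nat scalerA mulnC natrM mulVf ?scale1r //.
by rewrite mulf_neq0 ?pnatr_eq0.
Qed.

Lemma taylor_functional_sum M (I : finType) (F : I -> {poly {mpoly R[N]}}) :
  taylor_functional M (\sum_i F i) = \sum_i taylor_functional M (F i).
Proof.
rewrite exchange_big; apply: eq_bigr => k _.
by rewrite coef_sum scaler_sumr.
Qed.

Lemma taylor_functional_sqr_sos M w : ((size w).*2 <= M)%N ->
  is_sos (taylor_functional M (w ^+ 2)).
Proof.
move=> szM; set s := size w.
have [v vE] := taylor_weight_gram R s.
suff -> : taylor_functional M (w ^+ 2)
    = \sum_kl (\sum_(a < s) v kl a *: w`_a) ^+ 2.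
  by apply: is_sos_sum => kl; apply: is_sos_sqr.
transitivity (\sum_(a < s) \sum_(b < s)
    (((a + b).+1%:R * (a + b).+2%:R)^-1 : R) *: (w`_a * w`_b)).
  rewrite -[w in LHS]coefK poly_def expr2 big_distrlr /= taylor_functional_sum.
  apply: eq_bigr => a _; rewrite taylor_functional_sum; apply: eq_bigr => b _.
  have lt_abM : (a + b < M)%N.
    by rewrite (leq_trans _ szM) // -addnn -addSn leq_add // ltnW.
  rewrite -scalerAl -scalerAr scalerA -exprD /taylor_functional.
  rewrite (bigD1 (Ordinal lt_abM)) //= big1 ?addr0 => [|k kab].
    by rewrite coefZ coefXn eqxx mulr1.
  rewrite coefZ coefXn (_ : _ == _ = false) ?mulr0 ?scaler0 //.
  by apply: contraNF kab => /eqP kab; apply/eqP/val_inj.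
under eq_bigr do under eq_bigr do rewrite vE // scaler_suml.
under eq_bigr do rewrite exchange_big.
rewrite exchange_big; apply: eq_bigr => kl _; rewrite expr2 big_distrlr.
apply: eq_bigr => a _; apply: eq_bigr => b _ /=.
by rewrite -scalerAl -scalerAr scalerA.
Qed.

Lemma taylor_remainder_sos phi (I : finType) (w : I -> {poly {mpoly R[N]}}) :
  phi^`()^`() = \sum_i w i ^+ 2 -> is_sos (phi.[1] - phi.[0] - phi^`().[0]).
Proof.
move=> phi2; pose M := maxn (size phi) (\max_i (size (w i)).*2)%N.
rewrite (@taylor_remainderE M) ?phi2 => [|]; last first.
  by rewrite ltnW // ltnW // !ltnS leq_maxl.
rewrite taylor_functional_sum; apply: is_sos_sum => i.
apply: taylor_functional_sqr_sos; apply: leq_trans (leq_maxr _ _).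
exact: (leq_bigmax (F := fun i => (size (w i)).*2)).
Qed.

End Remainder.

(** * The equivalence *)

(** The remainder is that of the restriction of [p] to the segment from [x] to
    [y]. *)
Lemma sos_g_grad_of_hessian (R : realType) (n : nat) (p : {mpoly R[n]}) :
  is_sos_matrix (hessian p) -> is_sos (g_grad p).
Proof.
move=> [s [V defH]].
pose A := {mpoly R[n + n]}.
pose x i : A := xvars R n i 0; pose y i : A := yvars R n i 0.
pose line : {mpoly R[n]} -> {poly A} :=
  mmap (polyC \o @mpolyC (n + n) R) (fun i => (x i)%:P + (y i - x i)%:P * 'X).
have line_deriv q : (line q)^`() = \sum_i line q^`M(i) * (y i - x i)%:P.
  rewrite /line (chain_rule _ _ (D := deriv)) /=.
  - by apply: eq_bigr => i _; rewrite derivD derivM !derivC derivX; congr (_ * _);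
       ring.
  - by move=> a b; rewrite derivM.
  - by move=> c; rewrite derivC.
have line_horner q (z : A) (u : 'cV[A]_n) :
    (forall i, u i 0 = x i + (y i - x i) * z) -> (line q).[z] = msubst u q.
  move=> uE; rewrite /line /mmap horner_sum; apply: eq_bigr => m _.
  rewrite hornerM hornerC horner_prod; congr (_ * _).
  apply: eq_bigr => i _; rewrite tnth_mktuple uE horner_exp.
  by rewrite hornerD hornerM !hornerC hornerX.
have line_sum (I : finType) F : line (\sum_(i : I) F i) = \sum_i line (F i).
  exact: (rmorph_sum (mmap _ _)).
have lineM q1 q2 : line (q1 * q2) = line q1 * line q2.
  exact: (rmorphM (mmap _ _)).
have line0 q : (line q).[0] = msubst (xvars R n) q.
  by apply: line_horner => i; rewrite mulr0 addr0.
have line1 q : (line q).[1] = msubst (yvars R n) q.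
  by apply: line_horner => i; rewrite mulr1 addrC subrK.
have -> : g_grad p = (line p).[1] - (line p).[0] - (line p)^`().[0].
  rewrite line1 line0 /g_grad; congr (_ - _).
  rewrite line_deriv horner_sum mxE; apply: eq_bigr => i _.
  by rewrite hornerM hornerC line0 mxE [map_mx _ _ _ _]mxE [gradient _ _ _]mxE
             [(yvars R n - xvars R n) i 0]mxE [(- xvars R n) i 0]mxE.
apply: (@taylor_remainder_sos _ _ _ _
  (fun k : 'I_s => \sum_j line (V k j) * (y j - x j)%:P)).
(* From here on [line] is any ring morphism whose derivative in [t] obeys
   [line_deriv]. *)
clearbody line.
rewrite line_deriv raddf_sum /=.
transitivity (\sum_j \sum_i
   line (hessian p i j) * ((y i - x i)%:P * (y j - x j)%:P)).
  apply: eq_bigr => j _; rewrite derivM derivC mulr0 addr0 line_deriv mulr_suml.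
  by apply: eq_bigr => i _; rewrite mxE mulrA.
transitivity (\sum_j \sum_k \sum_i
   (line (V k j) * (y j - x j)%:P) * (line (V k i) * (y i - x i)%:P)).
  apply: eq_bigr => j _; rewrite [RHS]exchange_big; apply: eq_bigr => i _.
  rewrite defH mxE line_sum mulr_suml; apply: eq_bigr => k _.
  by rewrite mxE lineM; ring.
rewrite exchange_big; apply: eq_bigr => k _.
by rewrite expr2 big_distrlr.
Qed.

Theorem theorem3p5 (R : realType) (n d : nat) (p : {mpoly R[n]})
    (hd : (msize p).-1 = d) :
  [<-> is_sos (g_lambda p 2^-1);
       is_sos (g_grad p);
       is_sos (g_hess p);
       is_sos_matrix (hessian p)].
Proof.
tfae.
- by move/sos_hessian_of_g_lambda/sos_g_grad_of_hessian.
- by move/sos_g_lambda_of_g_grad/sos_hessian_of_g_lambda/sos_g_hess_of_hessian.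
- exact: sos_hessian_of_g_hess.
- by move/sos_g_grad_of_hessian/sos_g_lambda_of_g_grad.
Qed.
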